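(* Let $A\in\mathbb{R}^{m\times n}$ be such that $Ae_j\neq cAe_i$ for all $i,j\in\{1,\dots,n\}$ with $i\neq j$ and all $c\in\mathbb{R}$. Let $P=A^\dagger A$ be the orthogonal projection onto $\mathcal{N}(A)^\perp$, and let $W\in\mathbb{R}^{n\times n}$ be the diagonal matrix with $We_i=\|Pe_i\|_2\,e_i$, $i=1,\dots,n$. Then, for every $j\in\{1,\dots,n\}$, $e_j$ is the unique solution of the problem $$\min_{x\in\mathbb{R}^n}\|Wx\|_1\quad\text{subject to}\quad Ax=Ae_j,$$ and $e_j$ is also the unique solution of the problem $$\min_{x\in\mathbb{R}^n}\|Wx\|_1\quad\text{subject to}\quad Px=Pe_j.$$
   Context: $e_1,\dots,e_n$ are the standard basis vectors of $\mathbb{R}^n$, $\|\cdot\|_1$ and $\|\cdot\|_2$ are the $\ell^1$- and Euclidean norms, $A^\dagger$ is the Moore-Penrose inverse of $A$, and $\mathcal{N}(A)$ is the null space of $A$. It is assumed, as part of the definition of $W$, that $Pe_i\neq 0$ for $i=1,\dots,n$. *)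

(* Defs.v *)
From mathcomp Require Import all_boot all_order all_algebra.
From mathcomp Require Import boolp classical_sets reals.

Set Implicit Arguments.
Unset Strict Implicit.
Unset Printing Implicit Defensive.

Import Order.TTheory GRing.Theory Num.Theory.
Local Open Scope ring_scope.

Definition basis_vec (R : realType) (n : nat) (i : 'I_n) : 'cV[R]_n :=
  delta_mx i 0.

Definition l1norm (R : realType) (n : nat) (x : 'cV[R]_n) : R :=
  \sum_i `|x i 0|.

Definition l2norm (R : realType) (n : nat) (x : 'cV[R]_n) : R :=
  Num.sqrt (\sum_i x i 0 ^+ 2).

(* The four Penrose equations. *)
Definition penrose (R : realType) (m n : nat)
    (A : 'M[R]_(m, n)) (X : 'M[R]_(n, m)) : Prop :=
  [/\ A *m X *m A = A, X *m A *m X = X,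
      (A *m X)^T = A *m X & (X *m A)^T = X *m A].

(* The default value 0 is never used: see [pinvP]. The library's [pinvmx] is
   only some generalized inverse, not the Moore-Penrose one. *)
Definition pinv (R : realType) (m n : nat) (A : 'M[R]_(m, n)) : 'M[R]_(n, m) :=
  xget 0 [set X | penrose A X]%classic.

Definition weight_mx (R : realType) (n : nat) (P : 'M[R]_n) : 'M[R]_n :=
  diag_mx (\row_i l2norm (P *m basis_vec R i)).

Definition is_minimizer (R : realType) (T : Type) (f : T -> R)
    (feasible : T -> Prop) (x : T) : Prop :=
  feasible x /\ forall y, feasible y -> f x <= f y.

Definition is_unique_minimizer (R : realType) (T : Type) (f : T -> R)
    (feasible : T -> Prop) (x : T) : Prop :=
  is_minimizer f feasible x /\
  forall y, is_minimizer f feasible y -> y = x.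

Lemma weight_mxE (R : realType) (n : nat) (P : 'M[R]_n) (i : 'I_n) :
  weight_mx P *m basis_vec R i =
  l2norm (P *m basis_vec R i) *: basis_vec R i.
Proof.
apply/matrixP=> k l; rewrite mul_diag_mx !mxE.
by case: eqP => [->|_] //=; rewrite !mulr0.
Qed.

Lemma gram_unitmx (R : realType) (r n : nat) (F : 'M[R]_(r, n)) :
  row_free F -> F *m F^T \in unitmx.
Proof.
move=> Ffree; rewrite -row_free_unit -kermx_eq0; apply/rowV0P=> v.
move=> /sub_kermxP; rewrite mulmxA => vFF0.
suff vF0: v *m F = 0 by apply: (row_free_inj Ffree); rewrite vF0 mul0mx.
have /matrixP/(_ 0 0) : (v *m F) *m (v *m F)^T = 0.
  by rewrite trmx_mul mulmxA vFF0 mul0mx.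
rewrite !mxE => /eqP; rewrite psumr_eq0 => [/allP s0|k _]; last first.
  by rewrite [X in _ * X]mxE -expr2 sqr_ge0.
apply/rowP=> k; rewrite [RHS]mxE; have /= := s0 k (mem_index_enum k).
by rewrite [X in _ * X]mxE mulf_eq0 orbb => /eqP.
Qed.

Lemma penrose_exists (R : realType) (m n : nat) (A : 'M[R]_(m, n)) :
  exists X, penrose A X.
Proof.
have : exists r (C : 'M[R]_(m, r)) (F : 'M[R]_(r, n)),
    [/\ A = C *m F, row_full C & row_free F].
  exists (\rank A), (col_base A), (row_base A).
  by rewrite mulmx_base col_base_full row_base_free.
move=> [r [C [F [AE Cfull Ffree]]]].
have FU : F *m F^T \in unitmx by apply: gram_unitmx.
have CU : C^T *m C \in unitmx.
  rewrite -{2}[C]trmxK; apply: gram_unitmx.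
  by rewrite /row_free mxrank_tr.
pose X := F^T *m invmx (F *m F^T) *m (invmx (C^T *m C) *m C^T).
have AX : A *m X = C *m (invmx (C^T *m C) *m C^T).
  by rewrite AE /X !mulmxA -[C *m F *m F^T]mulmxA mulmxK.
have XA : X *m A = F^T *m invmx (F *m F^T) *m F.
  rewrite AE /X -!mulmxA; congr (_ *m (_ *m _)).
  by rewrite !mulmxA -[invmx _ *m C^T *m C]mulmxA mulVmx // mul1mx.
have sF : (F *m F^T)^T = F *m F^T by rewrite trmx_mul trmxK.
have sC : (C^T *m C)^T = C^T *m C by rewrite trmx_mul trmxK.
exists X; split.
- rewrite AX AE -!mulmxA; congr (_ *m _).
  by rewrite !mulmxA -[invmx _ *m C^T *m C]mulmxA mulVmx // mul1mx.
- rewrite XA /X -!mulmxA; congr (_ *m _).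
  by rewrite [F *m (F^T *m _)]mulmxA mulKVmx ?mulmxA.
- by rewrite AX !trmx_mul trmx_inv sC trmxK mulmxA.
- by rewrite XA !trmx_mul trmx_inv sF trmxK mulmxA.
Qed.

Lemma penrose_unique (R : realType) (m n : nat) (A : 'M[R]_(m, n))
    (X Y : 'M[R]_(n, m)) : penrose A X -> penrose A Y -> X = Y.
Proof.
move=> [X1 X2 X3 X4] [Y1 Y2 Y3 Y4].
have AXY : A *m X = A *m Y.
  by rewrite -X3 -{1}Y1 -(mulmxA (A *m Y)) trmx_mul X3 Y3 mulmxA X1.
have XYA : X *m A = Y *m A.
  by rewrite -X4 -{1}Y1 -[A *m Y *m A]mulmxA mulmxA trmx_mul X4 Y4 -!mulmxA
             [A *m (X *m A)]mulmxA X1.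
by rewrite -X2 XYA -mulmxA AXY mulmxA Y2.
Qed.

Lemma pinvP (R : realType) (m n : nat) (A : 'M[R]_(m, n)) :
  penrose A (pinv A).
Proof.
rewrite /pinv; case: xgetP => [X _ //|noX].
by have [X /noX] := penrose_exists A.
Qed.

(* [pinv A *m A] is the orthogonal projection onto the orthogonal complement
   of the null space of [A]. *)
Lemma pinv_proj (R : realType) (m n : nat) (A : 'M[R]_(m, n)) (x : 'cV[R]_n) :
  A *m (x - pinv A *m A *m x) = 0 /\
  forall z : 'cV[R]_n, A *m z = 0 -> z^T *m (pinv A *m A *m x) = 0.
Proof.
have [AXA _ _ sXA] := pinvP A; split.
  by rewrite mulmxBr !mulmxA AXA subrr.
move=> z Az; rewrite -sXA mulmxA -trmx_mul -[_ *m A *m z]mulmxA Az.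
by rewrite mulmx0 trmx0 mul0mx.
Qed.

(* Main.v *)
Require Import Defs.
From mathcomp Require Import all_boot all_order all_algebra.
From mathcomp Require Import boolp classical_sets reals.
From mathcomp Require Import ring lra.

Set Implicit Arguments.
Unset Strict Implicit.

Import Order.TTheory GRing.Theory Num.Theory.
Local Open Scope ring_scope.

(** Write [p_i = P e_i] and [w_i = |p_i|]. The identities [A P = A] and
    [P = pinv A *m A] show that [A] and [P] impose the same constraint
    ([pinv_eqE]), and that the columns of [P], like those of [A], are pairwise
    non-parallel. It then suffices to treat any square matrix with nonzero,
    pairwise non-parallel columns ([basis_vec_unique_minimizer]).

    If [P x = p_j], that is [p_j = \sum_i x_i p_i], pairing with [p_j] gives
    [w_j ^ 2 = \sum_i x_i <p_j, p_i> <= w_j * \sum_i w_i |x_i|] by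
    Cauchy-Schwarz, so the objective is at least [w_j], its value at [e_j].
    Cauchy-Schwarz is strict for non-parallel vectors, so equality forces
    [x_i = 0] for every [i] other than [j]; the constraint then reads
    [x_j p_j = p_j], whence [x_j = 1]. The normalization by [W] is what makes
    the Cauchy-Schwarz bound uniform in [i]. *)

Definition dot (R : realType) (n : nat) (u v : 'cV[R]_n) : R :=
  \sum_i u i 0 * v i 0.

Lemma l2norm_ge0 (R : realType) (n : nat) (u : 'cV[R]_n) : 0 <= l2norm u.
Proof. exact: sqrtr_ge0. Qed.

Lemma dot_self_ge0 (R : realType) (n : nat) (u : 'cV[R]_n) : 0 <= dot u u.
Proof. by apply: sumr_ge0 => i _; rewrite -expr2 sqr_ge0. Qed.

Lemma sqr_l2norm (R : realType) (n : nat) (u : 'cV[R]_n) :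
  l2norm u ^+ 2 = dot u u.
Proof.
have -> : dot u u = \sum_i u i 0 ^+ 2 by apply: eq_bigr => i _; rewrite expr2.
by rewrite sqr_sqrtr //; apply: sumr_ge0 => i _; rewrite sqr_ge0.
Qed.

Lemma dot_self_eq0 (R : realType) (n : nat) (u : 'cV[R]_n) :
  dot u u = 0 -> u = 0.
Proof.
move=> /psumr_eq0P u0; apply/matrixP => i k; rewrite ord1 mxE.
apply/eqP; rewrite -sqrf_eq0 expr2; apply/eqP/u0 => // l _.
by rewrite -expr2 sqr_ge0.
Qed.

Lemma l2norm_gt0 (R : realType) (n : nat) (u : 'cV[R]_n) :
  u <> 0 -> 0 < l2norm u.
Proof.
move=> u0; rewrite lt_def l2norm_ge0 andbT; apply/eqP => w0.
by apply/u0/dot_self_eq0; rewrite -sqr_l2norm w0 expr0n.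
Qed.

(** Lagrange's argument: the vector [|u|^2 v - <u,v> u] has squared norm
    [|u|^2 (|u|^2 |v|^2 - <u,v>^2)] and does not vanish. *)
Lemma cauchy_schwarz_strict (R : realType) (n : nat) (u v : 'cV[R]_n) :
  u <> 0 -> (forall c : R, v <> c *: u) -> `|dot u v| < l2norm u * l2norm v.
Proof.
move=> u0 nparallel.
have a0 : 0 < dot u u by rewrite -sqr_l2norm exprn_gt0 ?l2norm_gt0.
pose z := dot u u *: v - dot u v *: u.
have zE : dot z z = dot u u * (dot u u * dot v v - dot u v ^+ 2).
  suff expand a b : dot (a *: v - b *: u) (a *: v - b *: u) =
      a ^+ 2 * dot v v - 2 * a * b * dot u v + b ^+ 2 * dot u u.
    by rewrite expand; ring.
  rewrite /dot !mulr_sumr -sumrB -big_split /=.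
  by apply: eq_bigr => i _; rewrite !mxE; ring.
have z0 : 0 < dot z z.
  rewrite lt_def dot_self_ge0 andbT; apply/eqP => /dot_self_eq0 /eqP.
  rewrite subr_eq0 => /eqP av; apply: (nparallel (dot u v / dot u u)).
  by rewrite mulrC -scalerA -av scalerA mulVf ?scale1r // gt_eqF.
rewrite -(ltr_pXn2r (n := 2)) ?nnegrE ?mulr_ge0 ?l2norm_ge0 //.
by rewrite real_normK ?num_real // exprMn !sqr_l2norm -subr_gt0
           -(pmulr_rgt0 _ a0) -zE.
Qed.

Lemma l1norm_weight (R : realType) (n : nat) (M : 'M[R]_n) (x : 'cV[R]_n) :
  l1norm (weight_mx M *m x) =
  \sum_i l2norm (M *m basis_vec R i) * `|x i 0|.
Proof.
apply: eq_bigr => i _.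
by rewrite mul_diag_mx !mxE normrM ger0_norm ?l2norm_ge0.
Qed.

Lemma l1norm_weight_basis (R : realType) (n : nat) (M : 'M[R]_n) (j : 'I_n) :
  l1norm (weight_mx M *m basis_vec R j) = l2norm (M *m basis_vec R j).
Proof.
rewrite l1norm_weight (bigD1 j) //= big1 => [|i /negbTE ij].
  by rewrite mxE !eqxx normr1 mulr1 addr0.
by rewrite mxE ij normr0 mulr0.
Qed.

Lemma mulmx_basis_vec (R : realType) (m n : nat) (M : 'M[R]_(m, n)) i j :
  (M *m basis_vec R j) i 0 = M i j.
Proof. by rewrite -colE mxE. Qed.

Lemma dot_mulmx (R : realType) (m n : nat) (M : 'M[R]_(m, n)) u x :
  dot u (M *m x) = \sum_i x i 0 * dot u (M *m basis_vec R i).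
Proof.
rewrite /dot; under eq_bigr do rewrite mxE mulr_sumr.
under [RHS]eq_bigr do rewrite mulr_sumr.
rewrite exchange_big; apply: eq_bigr => i _; apply: eq_bigr => k _.
by rewrite mulmx_basis_vec; ring.
Qed.

Lemma cV_supported_at (R : realType) (n : nat) (x : 'cV[R]_n) (j : 'I_n) :
  (forall i, i != j -> x i 0 = 0) -> x = x j 0 *: basis_vec R j.
Proof.
move=> x0; apply/matrixP => i k; rewrite ord1 !mxE eqxx andbT.
by have [->|/x0 ->] := eqVneq i j; rewrite ?mulr1 ?mulr0.
Qed.

Lemma basis_vec_unique_minimizer (R : realType) (n : nat) (M : 'M[R]_n)
    (j : 'I_n) :
  (forall i, M *m basis_vec R i <> 0) ->
  (forall (i : 'I_n) (c : R), i <> j ->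
     M *m basis_vec R i <> c *: (M *m basis_vec R j)) ->
  is_unique_minimizer (fun x : 'cV[R]_n => l1norm (weight_mx M *m x))
    (fun x : 'cV[R]_n => M *m x = M *m basis_vec R j) (basis_vec R j).
Proof.
move=> M0 nparallel.
set p := fun i => M *m basis_vec R i.
have w0 i : 0 < l2norm (p i) by apply/l2norm_gt0/M0.
(* the slack of Cauchy-Schwarz in the i-th term *)
pose gap (y : 'cV[R]_n) i :=
  l2norm (p j) * (l2norm (p i) * `|y i 0|) - y i 0 * dot (p j) (p i).
have gap_sum y : M *m y = p j ->
    \sum_i gap y i
    = l2norm (p j) * (l1norm (weight_mx M *m y) - l2norm (p j)).
  move=> yE; rewrite sumrB -mulr_sumr -l1norm_weight -dot_mulmx yE.
  by rewrite -sqr_l2norm; ring.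
have gap_lb (y : 'cV[R]_n) i : i != j ->
    (l2norm (p j) * l2norm (p i) - `|dot (p j) (p i)|) * `|y i 0| <= gap y i.
  move=> ij; have := ler_norm (y i 0 * dot (p j) (p i)).
  by rewrite /gap normrM; lra.
have slack i : i != j -> 0 < l2norm (p j) * l2norm (p i) - `|dot (p j) (p i)|.
  move=> /eqP ij; rewrite subr_gt0; apply: (cauchy_schwarz_strict (M0 j)) => c.
  exact: nparallel.
have gap_ge0 y i : 0 <= gap y i.
  have [->|ij] := eqVneq i j; last first.
    by apply: le_trans (gap_lb y i ij); rewrite mulr_ge0 // ltW ?slack.
  rewrite /gap -sqr_l2norm mulrA -expr2 mulrC -mulrBl mulr_ge0 ?sqr_ge0 //.
  by rewrite subr_ge0 ler_norm.
have e_min : is_minimizer (fun x : 'cV[R]_n => l1norm (weight_mx M *m x))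
    (fun x : 'cV[R]_n => M *m x = p j) (basis_vec R j).
  split=> // y /gap_sum sumE; rewrite l1norm_weight_basis -subr_ge0.
  by rewrite -(pmulr_rge0 _ (w0 j)) -sumE sumr_ge0.
split=> // y [yE ymin].
have gap0 i : gap y i = 0.
  apply: (psumr_eq0P (P := xpredT)) => //.
  have -> : \sum_i gap y i = 0; last by [].
  rewrite gap_sum //; apply/eqP; rewrite mulf_eq0 subr_eq0; apply/orP; right.
  rewrite -l1norm_weight_basis eq_le.
  by rewrite (ymin _ e_min.1) (e_min.2 _ yE).
have y0 i : i != j -> y i 0 = 0.
  move=> ij; apply/normr0_eq0/eqP; rewrite eq_le normr_ge0 andbT.
  by rewrite -(pmulr_rle0 _ (slack i ij)) -(gap0 i) gap_lb.
move: yE; rewrite (cV_supported_at y0) -scalemxAr => /eqP.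
rewrite -subr_eq0 -[X in _ - X]scale1r -scalerBl scaler_eq0 subr_eq0.
by case/orP=> /eqP => [->|/M0 //]; rewrite scale1r.
Qed.

Lemma pinv_eqE (R : realType) (m n : nat) (A : 'M[R]_(m, n)) (x y : 'cV[R]_n) :
  A *m x = A *m y <-> pinv A *m A *m x = pinv A *m A *m y.
Proof.
split=> [xy|]; first by rewrite -!mulmxA xy.
have [AXA _ _ _] := pinvP A.
by move/(congr1 (mulmx A)); rewrite !mulmxA AXA.
Qed.

Unset Implicit Arguments.
Set Strict Implicit.

Theorem theorem4p2 (R : realType) (m n : nat) (A : 'M[R]_(m, n)) :
  (forall (i j : 'I_n) (c : R), i <> j ->
     A *m basis_vec R j <> c *: (A *m basis_vec R i)) ->
  let P : 'M[R]_n := pinv A *m A in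
  (forall i : 'I_n, P *m basis_vec R i <> 0) ->
  let W : 'M[R]_n := weight_mx P in
  forall j : 'I_n,
    is_unique_minimizer (fun x : 'cV[R]_n => l1norm (W *m x))
      (fun x : 'cV[R]_n => A *m x = A *m basis_vec R j) (basis_vec R j) /\
    is_unique_minimizer (fun x : 'cV[R]_n => l1norm (W *m x))
      (fun x : 'cV[R]_n => P *m x = P *m basis_vec R j) (basis_vec R j).
Proof.
move=> nparallel P P0 W j.
have Pmin : is_unique_minimizer (fun x : 'cV[R]_n => l1norm (W *m x))
    (fun x : 'cV[R]_n => P *m x = P *m basis_vec R j) (basis_vec R j).
  apply: basis_vec_unique_minimizer => // i c ij.
  rewrite scalemxAr => /(pinv_eqE A _ _).2; rewrite -scalemxAr.
  exact: nparallel (nesym ij).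
split=> //; have -> // : (fun x : 'cV[R]_n => A *m x = A *m basis_vec R j)
    = (fun x => P *m x = P *m basis_vec R j).
by apply/funext => x; apply/propext/pinv_eqE.
Qed.
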